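(* Consider the following game over slots $1,\dots,T$ with $N\ge2$ users and an integer $1\le k\le N$. The BS chooses a probability distribution on $k$-element subsets of the users. In every slot it independently schedules a $k$-subset drawn from this distribution. The adversary chooses a blocking matrix $\sigma\in\{0,1\}^{N\times T}$, where $\sigma_i(t)=0$ means user $i$ is blocked in slot $t$. Feasibility means $\sum_{i,t}(1-\sigma_i(t))\le\alpha T$ and $\sum_i(1-\sigma_i(t))\le k_a$ for each $t$, where $k_a\ge1$ and $0<\alpha<1$. Ages satisfy $a_i(1)=1$, $a_i(t+1)=1$ if user $i$ is scheduled and not blocked in slot $t$, and $a_i(t+1)=a_i(t)+1$ otherwise. The payoff $\Delta$ is the average age $\frac1T\sum_{t=1}^T\frac1N\sum_i\mathbb E[a_i(t)]$. Consider: - a BS distribution under which every user is scheduled in a given slot with probability $\frac kN$; and - the adversarial action that blocks one arbitrary user exactly in the slots $\frac{(1-\alpha)T}2+1,\dots,\frac{(1+\alpha)T}2$ and nothing else. Then, for all sufficiently large $T$ with $\alpha T\in\mathbb Z$ and $(1-\alpha)T$ even, this pair is a Stackelberg equilibrium with the BS as leader. That is: - the adversarial action maximizes $\Delta$ against the given BS distribution; and - the given BS distribution minimizes $\max_{\sigma\text{ feasible}}\Delta$ over all distributions on $k$-subsets. *)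

(* Defs.v *)
From HB Require Import structures.
From mathcomp Require Import all_boot all_order all_algebra.
From mathcomp Require Import reals.
Set Implicit Arguments. Unset Strict Implicit. Unset Printing Implicit Defensive.
Import Order.TTheory GRing.Theory Num.Theory.
Local Open Scope ring_scope.

Section Game.
Variables (R : realType) (N T : nat).

(* Blocking matrix: sigma (i, t) = false means user i is blocked in
   slot t+1 (slots are 0-indexed by 'I_T). *)
Definition blocking := {ffun 'I_N * 'I_T -> bool}.

Definition schedule := {ffun 'I_T -> {set 'I_N}}.

Definition is_dist (k : nat) (p : {set 'I_N} -> R) : Prop :=
  [/\ forall S : {set 'I_N}, 0 <= p S,
      forall S : {set 'I_N}, #|S| != k -> p S = 0 &
      \sum_(S : {set 'I_N}) p S = 1].

Definition feasible (alpha : R) (ka : nat) (sigma : blocking) : Prop :=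
  (#|[set x | ~~ sigma x]|%:R <= alpha * T%:R) /\
  (forall t : 'I_T, #|[set i : 'I_N | ~~ sigma (i, t)]| <= ka)%N.

Definition feasibleb (alpha : R) (ka : nat) (sigma : blocking) : bool :=
  (#|[set x | ~~ sigma x]|%:R <= alpha * T%:R) &&
  [forall t : 'I_T, #|[set i : 'I_N | ~~ sigma (i, t)]| <= ka]%N.

Definition sched_at (f : schedule) (n : nat) : {set 'I_N} :=
  if insub n is Some t then f t else set0.
Definition unblocked_at (sigma : blocking) (i : 'I_N) (n : nat) : bool :=
  if insub n is Some t then sigma (i, t) else true.

Fixpoint age (f : schedule) (sigma : blocking) (i : 'I_N) (n : nat) : nat :=
  match n with
  | 0 => 1
  | n'.+1 => if (i \in sched_at f n') && unblocked_at sigma i n' then 1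
             else (age f sigma i n').+1
  end.

Definition sched_prob (p : {set 'I_N} -> R) (f : schedule) : R :=
  \prod_(t : 'I_T) p (f t).

Definition expected_age (p : {set 'I_N} -> R) (sigma : blocking)
  (i : 'I_N) (n : nat) : R :=
  \sum_(f : schedule) sched_prob p f * (age f sigma i n)%:R.

Definition Delta (p : {set 'I_N} -> R) (sigma : blocking) : R :=
  (T%:R)^-1 * \sum_(t < T) ((N%:R)^-1 * \sum_(i : 'I_N) expected_age p sigma i t).

(* Worst-case payoff over feasible blocking matrices (Delta >= 0 and the
   all-unblocked matrix is feasible, so 0 is a harmless initial value). *)
Definition worst_Delta (alpha : R) (ka : nat) (p : {set 'I_N} -> R) : R :=
  \big[Num.max/0]_(sigma : blocking | feasibleb alpha ka sigma) Delta p sigma.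

Definition middle_block (alpha : R) (i0 : 'I_N) : blocking :=
  [ffun x : 'I_N * 'I_T =>
     ~~ [&& x.1 == i0,
            (1 - alpha) * T%:R / 2 + 1 <= (x.2 : nat).+1%:R &
            (x.2 : nat).+1%:R <= (1 + alpha) * T%:R / 2]].

End Game.

(* Main.v *)
(**
  If user [i] is scheduled in a slot with probability [q], its mean age obeys
  [e(n+1) = 1 + rho_n e(n)] where [rho_n] is [r = 1 - q] in an unblocked slot
  and [1] in a blocked one, so only the marginals of the distribution matter.

  Along a pattern with [L] unblocked and [c] blocked slots, write [R_j] for
  [1 + r + ... + r^j].  A blocked slot with [j] unblocked slots before it
  contributes [R_j + R_(L-j) - 1] through its interaction with the unblocked
  slots, which is largest when [j] is central, and the blocked slots interact
  with each other by at most [c (c + 1) / 2], attained when they are adjacent.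
  This settles the case of a single user.  The gain is quadratic in [c] up to
  boundary terms of order [r^h], [2h] being the number of slots outside the
  block; hence for large [T] the gain per blocked slot is maximal when the
  whole budget [b] is spent on one user.

  For the leader, the worst case against another distribution is at least the
  average over the blocked user of the payoffs of the central block.  Mean ages
  are convex in [r], and the marginals have mean [k / N], so by Jensen's
  inequality this average is at least the payoff for uniform marginals.
*)
Require Import Defs.
From HB Require Import structures.
From mathcomp Require Import all_boot all_order all_algebra.
From mathcomp Require Import reals.
From mathcomp Require Import zify ring lra.
Import Order.TTheory GRing.Theory Num.Theory.
Local Open Scope ring_scope.

(** * Mean age of one user and geometric sums *)

Section MeanAge.
Context {R : realType}.
Implicit Types (r x y M : R) (s : nat -> bool) (w : seq bool).

Fixpoint mean_age r s n : R :=
  if n is n'.+1 then 1 + (if s n' then r else 1) * mean_age r s n' else 1.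

(** The letters of [w] drive the steps between consecutive slots, so [size w + 1] ages are summed.
    The free initial age [x] is what inductions on [w] generalize over. *)
Fixpoint age_sum r x w : R :=
  if w is b :: w' then x + age_sum r (1 + (if b then r else 1) * x) w' else x.

Definition geom r n : R := \sum_(j < n.+1) r ^+ j.

Lemma geom0 r : geom r 0 = 1.
Proof. by rewrite /geom big_ord1. Qed.

Lemma geomS r n : geom r n.+1 = 1 + r * geom r n.
Proof.
rewrite /geom big_ord_recl expr0 mulr_sumr; congr (_ + _).
by apply: eq_bigr => j _; rewrite -exprS.
Qed.

Lemma mul_geom r n : (1 - r) * geom r n = 1 - r ^+ n.+1.
Proof.
rewrite -[1 in RHS](expr1n _ n.+1) subrXX; congr (_ * _).
by apply: eq_bigr => j _; rewrite expr1n mul1r.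
Qed.

Lemma le_geom r m n : 0 <= r -> (m <= n)%N -> geom r m <= geom r n.
Proof.
move=> r0 /subnK <-; elim: (n - m)%N => //= d IH; rewrite addSn.
by apply: le_trans IH _; rewrite /geom [leRHS]big_ord_recr /= lerDl exprn_ge0.
Qed.

Lemma geomE r n : r < 1 -> geom r n = (1 - r ^+ n.+1) / (1 - r).
Proof. by move=> r1; rewrite -mul_geom mulrAC divff ?mul1r //; lra. Qed.

Lemma geom_le_lim r n : 0 <= r -> r < 1 -> geom r n <= (1 - r)^-1.
Proof.
move=> r0 r1; rewrite geomE // ler_piMl ?invr_ge0 ?subr_ge0 ?(ltW r1) //.
by rewrite lerBlDr lerDl exprn_ge0.
Qed.

(** By symmetry [l <= h]; in closed form the right side minus the left is then [(1 - r ^+ (h - l)) *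
    (r ^+ l.+1 - r ^+ h.+2)] divided by [1 - r]. *)
Lemma geom_add_le r h l : 0 <= r -> r < 1 -> (l <= h.*2.+1)%N ->
  geom r l + geom r (h.*2.+1 - l) <= geom r h.+1 + geom r h.
Proof.
move=> r0 r1.
wlog lh : l / (l <= h)%N => [H|_].
  move=> le; case: (leqP l h) => lh; first exact: H.
  have := H (h.*2.+1 - l)%N; rewrite subKn // addrC; apply; lia.
rewrite !geomE // -!mulrDl ler_pM2r ?invr_gt0 ?subr_gt0 //.
rewrite (_ : (h.*2.+1 - l).+1 = (h - l) + h.+2)%N; last by rewrite -addnn; lia.
have -> : r ^+ h.+1 = r ^+ (h - l) * r ^+ l.+1.
  by rewrite -exprD; congr (_ ^+ _); lia.
rewrite exprD.
have a1 : r ^+ (h - l) <= 1 by rewrite exprn_ile1 ?(ltW r1).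
have a2 : r ^+ h.+2 <= r ^+ l.+1 by rewrite ler_wiXn2l ?(ltW r1) //; lia.
have := mulr_ge0 (_ : 0 <= 1 - r ^+ (h - l)) (_ : 0 <= r ^+ l.+1 - r ^+ h.+2).
rewrite !subr_ge0 => /(_ a1 a2).
move: (r ^+ (h - l)) (r ^+ l.+1) (r ^+ h.+2) => a b c; lra.
Qed.

(** Powers of [r] decrease, so [n * r ^+ n] is at most their sum, hence at most [1 / (1 - r)]. *)
Lemma expr_small r e : 0 <= r -> r < 1 -> 0 < e ->
  forall n : nat, ((1 - r) * e)^-1 <= n%:R -> r ^+ n <= e.
Proof.
move=> r0 r1 e0 n hn.
have q0 : 0 < 1 - r by lra.
have n0 : (0 : R) < n%:R by apply: lt_le_trans hn; rewrite invr_gt0 mulr_gt0.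
have le_n : n%:R * r ^+ n <= (1 - r)^-1.
  apply: le_trans (geom_le_lim r n r0 r1); rewrite /geom big_ord_recr /=.
  rewrite -[leLHS]addr0 lerD ?exprn_ge0 // mulr_natl -[n in _ *+ n]card_ord -sumr_const.
  by apply: ler_sum => j _; rewrite ler_wiXn2l ?(ltW r1) // ltnW.
move: hn; rewrite invfM -ler_pdivlMr ?invr_gt0 // invrK => hn.
have := le_trans le_n hn; rewrite ler_pM2l //.
Qed.

(** * Sums of ages along a blocking pattern *)

Lemma age_sum_mean_age r s n m :
  age_sum r (mean_age r s n) (map s (iota n m)) =
  \sum_(n <= j < (n + m).+1) mean_age r s j.
Proof.
elim: m n => [|m IH] n /=; first by rewrite addn0 big_nat1.
rewrite (IH n.+1) addSnnS [RHS]big_ltn //; lia.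
Qed.

Lemma age_sum_cat_nseq_true r l n w :
  age_sum r (geom r l) (nseq n true ++ w) =
  \sum_(l <= j < l + n) geom r j + age_sum r (geom r (l + n)) w.
Proof.
elim: n l => [|n IH] l /=; first by rewrite addn0 big_geq ?add0r.
by rewrite -geomS IH addSnnS [in RHS]big_ltn ?addrA //; lia.
Qed.

Lemma age_sum_nseq_true r l x n :
  age_sum r (geom r l + x) (nseq n true) =
  \sum_(l <= j < (l + n).+1) geom r j + x * geom r n.
Proof.
elim: n l x => [|n IH] l x /=; first by rewrite addn0 big_nat1 geom0 mulr1.
have -> : 1 + r * (geom r l + x) = geom r l.+1 + r * x by rewrite geomS; ring.
rewrite IH addSnnS [in RHS]big_ltn; last lia.
rewrite [in RHS]geomS; ring.
Qed.

Lemma age_sum_block r l x n b :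
  age_sum r (geom r l + x) (nseq b false ++ nseq n true) =
  \sum_(l <= j < (l + n).+1) geom r j + x * geom r n
    + b%:R * (geom r l + geom r n - 1) + x * b%:R + b%:R * b.+1%:R / 2.
Proof.
elim: b x => [|b IH] x /=; first by rewrite age_sum_nseq_true; ring.
rewrite (_ : 1 + 1 * _ = geom r l + (x + 1)); last by ring.
by rewrite IH -!natr1; field.
Qed.

(* [x] is the excess age due to the slots blocked so far: each of them adds 1,
   and the excess decays by a factor [r] at every unblocked slot. *)
Lemma age_sum_le r l x w M : 0 <= r -> r <= 1 -> 0 <= x ->
  (forall j, (j <= l + count id w)%N ->
     geom r j + geom r (l + count id w - j) - 1 <= M) ->
  age_sum r (geom r l + x) w <=
  \sum_(l <= j < (l + count id w).+1) geom r j + x * geom r (count id w)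
    + (count negb w)%:R * M + x * (count negb w)%:R
    + (count negb w)%:R * (count negb w).+1%:R / 2.
Proof.
move=> r0 r1; elim: w l x => [|[] w IH] l x x0 hM /=.
- rewrite !addn0 big_nat1 geom0; lra.
- have -> : 1 + r * (geom r l + x) = geom r l.+1 + r * x by rewrite geomS; ring.
  have := IH l.+1 (r * x) (mulr_ge0 r0 x0).
  rewrite !add0n !add1n !addSnnS; move=> /(_ hM) h.
  rewrite [in leRHS]big_ltn; last lia.
  rewrite [geom r (count id w).+1]geomS.
  (* Later blocked slots are charged as if the excess had not decayed. Starting from zero excess,
     nothing is lost here when the blocked slots are adjacent. *)
  have : r * x * (count negb w)%:R <= x * (count negb w)%:R.
    by rewrite ler_wpM2r // ler_piMl.
  move: h; set S := \sum_(_ <= _ < _) _ => h hx. lra.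
- rewrite !add0n !add1n (_ : 1 + 1 * _ = geom r l + (x + 1)); last by ring.
  have h := IH l (x + 1) ltac:(lra) hM.
  have := hM l (leq_addr _ _); rewrite addKn /= add0n => hl.
  rewrite -[(count negb w).+2%:R]natr1; move: h.
  rewrite -[(count negb w).+1%:R]natr1; set S := \sum_(_ <= _ < _) _ => h.
  lra.
Qed.

(** * Convexity in the probability of not being scheduled *)

Lemma mean_age_subgradient r s n : 0 <= r ->
  exists2 c : R, 0 <= c &
    forall y, 0 <= y -> mean_age r s n + c * (y - r) <= mean_age y s n.
Proof.
move=> r0; have age0 m : 0 <= mean_age r s m.
  by elim: m => //= m IH; case: (s m); rewrite addr_ge0 // mulr_ge0.
elim: n => [|n [c c0 IH]] /=; first by exists 0 => // y y0; rewrite mul0r addr0.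
case: (s n); last first.
  by exists c => // y /IH; lra.
exists (mean_age r s n + r * c) => [|y y0]; first by rewrite addr_ge0 // mulr_ge0.
have := ler_wpM2l y0 (IH y y0); have := mulr_ge0 c0 (sqr_ge0 (y - r)); nra.
Qed.

Lemma mean_age_jensen (I : finType) r (ri : I -> R) s n :
  (forall i, 0 <= ri i) -> 0 <= r -> \sum_i ri i = #|I|%:R * r ->
  #|I|%:R * mean_age r s n <= \sum_i mean_age (ri i) s n.
Proof.
move=> ri0 r0 sum_ri; have [c _ hc] := mean_age_subgradient r s n r0.
apply: (@le_trans _ _ (\sum_i (mean_age r s n + c * (ri i - r)))); last first.
  by apply: ler_sum => i _; apply: hc.
rewrite big_split /= -mulr_sumr sumrB sum_ri !sumr_const cardT -cardE.
by rewrite !mulr_natl subrr mulr0 addr0.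
Qed.

(** * Optimality of the centred block for one user *)

(** The block is central in the full horizon, with [h.+1] free slots on each side; the last slot
    affects no age and is left out. *)
Definition block_pattern h b : seq bool :=
  nseq h.+1 true ++ nseq b false ++ nseq h true.

Lemma half_block_half h b : (h.+1 + (b + h) = h.*2.+1 + b)%N.
Proof. lia. Qed.

Lemma age_sum_no_block r n :
  age_sum r 1 (nseq n true) = \sum_(0 <= j < n.+1) geom r j.
Proof.
have := age_sum_nseq_true r 0 0 n.
by rewrite geom0 addr0 mul0r addr0 add0n.
Qed.

Lemma age_sum_block_pattern r h b :
  age_sum r 1 (block_pattern h b) =
  \sum_(0 <= j < h.*2.+2) geom r j
    + b%:R * (geom r h.+1 + geom r h - 1) + b%:R * b.+1%:R / 2.
Proof.
have := age_sum_cat_nseq_true r 0 h.+1 (nseq b false ++ nseq h true).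
rewrite geom0 => ->; rewrite -[geom r _]addr0 age_sum_block !add0n !mul0r !addr0.
rewrite !addrA -big_cat_nat //; last by lia.
by rewrite addSn addnn.
Qed.

(** Three geometric sums get compared with their limit against a total slack of [1 / 2], hence
    [1 / 6] for each. *)
Lemma geom_near_lim r h j : 0 <= r -> r < 1 -> r ^+ h.+1 <= (1 - r) / 6 ->
  (h <= j)%N -> (1 - r)^-1 - 6^-1 <= geom r j.
Proof.
move=> r0 r1 rh hj; apply: le_trans (le_geom r h j r0 hj).
rewrite geomE // mulrBl mul1r lerB // ler_pdivrMr 1?mulrC //; lra.
Qed.

(* The gain from [c] blocked slots is at most [c / b] times the gain of the
   centred block of length [b].  For [c < b] the slack is the difference
   between [(c + 1) / 2] and [(b + 1) / 2], which is at least [1 / 2] and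
   absorbs the boundary effects of order [r ^+ h]. *)
Lemma age_sum_le_block_pattern r h b w : 0 <= r -> r < 1 ->
  r ^+ h.+1 <= (1 - r) / 6 -> (0 < b)%N ->
  size w = (h.*2.+1 + b)%N ->
  (count negb w <= b)%N ->
  age_sum r 1 w <=
  age_sum r 1 (nseq (size w) true) + (count negb w)%:R *
    ((age_sum r 1 (block_pattern h b) - age_sum r 1 (nseq (size w) true)) / b%:R).
Proof.
move=> r0 r1 rh b0 szw cb; rewrite szw; set base := age_sum r 1 (nseq _ true).
have b0' : (0 : R) < b%:R by rewrite ltr0n.
have cE : (count id w + count negb w = h.*2.+1 + b)%N by rewrite -szw -(count_predC id).
have := @age_sum_le r 0 0 w _ r0 (ltW r1) (lexx 0).
rewrite geom0 addr0 !add0n !mul0r !addr0.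
case: (ltnP (count negb w) b) => [cltb|bc]; last first.
  have cw : count negb w = b by apply/eqP; rewrite eqn_leq cb.
  have -> : count id w = h.*2.+1 by lia.
  move=> /(_ (geom r h.+1 + geom r h - 1)); rewrite cw addr0 => H.
  rewrite [_ * (_ / _)]mulrC divfK ?lt0r_neq0 // [base + _]addrC subrK.
  rewrite age_sum_block_pattern.
  apply: H => j hj; rewrite lerB //; exact: geom_add_le.
(* Now [w] has more than [h.*2.+1] unblocked slots, and the limit of the geometric sums serves as a
   cruder bound than [geom_add_le]. *)
move=> /(_ ((1 - r)^-1 + (1 - r)^-1 - 1)); rewrite addr0 => H.
apply: le_trans (H _) _ => [j _|].
  by rewrite lerB // lerD // geom_le_lim.
set c := count negb w in cltb cE *.
(* With [m] unblocked slots only the first [m + 1] terms of [base] appear. The missing ones are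
   bounded below for [w] ([lo]) and above for the block ([hi]). *)
have split_base m : (m <= h.*2.+1 + b)%N ->
    base = \sum_(0 <= j < m.+1) geom r j + \sum_(m.+1 <= j < (h.*2.+1 + b).+1) geom r j.
  by move=> hm; rewrite -big_cat_nat // /base age_sum_no_block.
have lo : c%:R * geom r h.*2.+1 <=
    \sum_((count id w).+1 <= j < (h.*2.+1 + b).+1) geom r j.
  apply: (@le_trans _ _ (\sum_((count id w).+1 <= j < (h.*2.+1 + b).+1) geom r h.*2.+1)).
    rewrite sumr_const_nat mulr_natl (_ : (_ - _)%N = c) //; lia.
  by apply: ler_sum_nat => j hj; apply: le_geom => //; lia.
have hi : \sum_(h.*2.+2 <= j < (h.*2.+1 + b).+1) geom r j <= b%:R * (1 - r)^-1.
  apply: (@le_trans _ _ (\sum_(h.*2.+2 <= j < (h.*2.+1 + b).+1) (1 - r)^-1)).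
    by apply: ler_sum_nat => j hj; apply: geom_le_lim.
  rewrite sumr_const_nat mulr_natl (_ : (_ - _)%N = b) //; lia.
have gain : geom r h.+1 + geom r h - 1 - (1 - r)^-1 + b.+1%:R / 2 <=
    (age_sum r 1 (block_pattern h b) - base) / b%:R.
  rewrite ler_pdivlMr // age_sum_block_pattern (split_base h.*2.+1) ?leq_addr //.
  move: hi; set S1 := \sum_(_ <= _ < _) _; set S0 := \sum_(_ <= _ < _) _; lra.
have cb' : (c.+1%:R : R) + 1 <= b.+1%:R by rewrite natr1 ler_nat.
have g0 := geom_near_lim r h h.+1 r0 r1 rh (leqnSn h).
have g1 := geom_near_lim r h h r0 r1 rh (leqnn h).
have g2 : (1 - r)^-1 - 6^-1 <= geom r h.*2.+1.
  by apply: geom_near_lim rh _ => //; rewrite -addnn leqW ?leq_addl.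
set K := (_ - base) / _ in gain *.
have : c%:R * ((1 - r)^-1 + (1 - r)^-1 - 1 + c.+1%:R / 2 - geom r h.*2.+1) <= c%:R * K.
  apply: ler_wpM2l => //; apply: le_trans gain; lra.
have cN : (count id w <= h.*2.+1 + b)%N by rewrite -cE leq_addr.
rewrite (split_base _ cN).
move: lo; set S1 := \sum_(_.+1 <= _ < _) _; set S0 := \sum_(_ <= _ < _) _.
move=> lo; lra.
Qed.

Lemma age_sum_nseq_true_le r x y w : 0 <= r -> r <= 1 -> 0 <= x -> x <= y ->
  age_sum r x (nseq (size w) true) <= age_sum r y w.
Proof.
move=> r0 r1; elim: w x y => [|b w IH] x y x0 xy //=.
rewrite lerD // IH ?addr_ge0 ?mulr_ge0 // lerD2l.
case: b; first by rewrite ler_wpM2l.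
by rewrite mul1r (le_trans _ xy) // ler_piMl.
Qed.

Lemma age_sum_jensen (I : finType) r (ri : I -> R) w :
  (forall i, 0 <= ri i) -> 0 <= r -> \sum_i ri i = #|I|%:R * r ->
  #|I|%:R * age_sum r 1 w <= \sum_i age_sum (ri i) 1 w.
Proof.
move=> ri0 r0 sum_ri.
have E y : age_sum y 1 w = \sum_(0 <= j < (size w).+1) mean_age y (nth true w) j.
  by rewrite -[(size w).+1]add0n -(age_sum_mean_age y (nth true w) 0) [map _ _]mkseq_nth.
rewrite E mulr_sumr (eq_bigr _ (fun i _ => E (ri i))) exchange_big.
by apply: ler_sum => j _; apply: mean_age_jensen.
Qed.

Lemma age_sum_ge0 r x w : 0 <= r -> 0 <= x -> 0 <= age_sum r x w.
Proof.
move=> r0; elim: w x => //= b w IH x x0.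
by rewrite addr_ge0 // IH // addr_ge0 // mulr_ge0 //; case: b.
Qed.

End MeanAge.

(** * From random schedules to marginals and patterns *)

Section Game.
Context {R : realType} {N T : nat}.
Implicit Types (p : {set 'I_N} -> R) (sigma : blocking N T) (i : 'I_N).

Definition marginal p i : R := \sum_(S : {set 'I_N} | i \in S) p S.

(* [h] lets the weights of the slots from [n] on differ from [p]: the factor
   by which slot [n] multiplies the age is absorbed into [h n]. *)
Lemma sum_weight_age p sigma i n (h : 'I_T -> {set 'I_N} -> R) :
  \sum_S p S = 1 -> (n <= T)%N -> (forall t : 'I_T, (t < n)%N -> h t = p) ->
  \sum_(f : schedule N T) (\prod_t h t (f t)) * (age f sigma i n)%:R =
  mean_age (1 - marginal p i) (unblocked_at sigma i) n * \prod_t \sum_S h t S.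
Proof.
move=> p1; elim: n h => [|n IH] h nT hp /=.
  by rewrite mul1r bigA_distr_bigA; apply: eq_bigr => f _; rewrite mulr1.
pose t0 := Ordinal nT.
have insub_n : insub n = Some t0 :> option 'I_T by rewrite insubT.
pose idle (S : {set 'I_N}) : R := ((i \notin S) || ~~ sigma (i, t0))%:R.
pose h' t S := if t == t0 then h t S * idle S else h t S.
have ht0 : h t0 = p by apply: hp.
have idleE : \sum_S h' t0 S =
    if unblocked_at sigma i n then 1 - marginal p i else 1.
  rewrite /unblocked_at insub_n /h' eqxx ht0 /idle; case: (sigma _) => /=.
    rewrite -[X in X - marginal _ _]p1.
    rewrite [X in _ = X - _](bigID (fun S : {set 'I_N} => i \in S)) /=.
    rewrite [X in _ = X - _]addrC addrK.
    rewrite [RHS]big_mkcond; apply: eq_bigr => S _.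
    by case: (i \in S); rewrite /= ?mulr0 ?mulr1.
  by rewrite -[RHS]p1; apply: eq_bigr => S _; rewrite orbT mulr1.
(* The next age is 1 plus [idle] times the current one, and [h'] carries the factor [idle]. *)
transitivity (\sum_(f : schedule N T) (\prod_t h t (f t)) +
  \sum_(f : schedule N T) (\prod_t h' t (f t)) * (age f sigma i n)%:R).
  rewrite -big_split; apply: eq_bigr => f _ /=.
  rewrite [X in _ = _ + X * _](bigD1 t0) //= /h' eqxx.
  rewrite [X in _ + _ * X * _](eq_bigr (fun t => h t (f t))); last first.
    by move=> t /negPf ->.
  rewrite (bigD1 t0) //= /sched_at /unblocked_at insub_n /idle.
  by case: (sigma _); case: (i \in f t0) => /=; rewrite -?natr1; ring.
rewrite -bigA_distr_bigA IH ?(ltnW nT) //; last first.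
  move=> t tn; rewrite -(hp t (ltnW tn)) /h' -val_eqE /=.
  by rewrite (ltn_eqF tn).
rewrite mulrDl mul1r; congr (_ + _).
rewrite [in RHS](bigD1 t0) //= ht0 p1 mul1r (bigD1 t0) //= idleE.
rewrite mulrA [mean_age _ _ _ * _]mulrC; congr (_ * _).
by apply: eq_bigr => t /negPf tt0; apply: eq_bigr => S _; rewrite /h' tt0.
Qed.

Lemma expected_ageE p sigma i n : \sum_S p S = 1 -> (n <= T)%N ->
  expected_age p sigma i n =
  mean_age (1 - marginal p i) (unblocked_at sigma i) n.
Proof.
move=> p1 nT; have := @sum_weight_age p sigma i n (fun=> p) p1 nT.
by rewrite prodr_const p1 expr1n mulr1; apply.
Qed.

Definition pattern sigma i : seq bool := map (unblocked_at sigma i) (iota 0 T.-1).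

(* Blocking in the last slot influences no age [a_i(t)] with [t <= T]. *)
Lemma sum_mean_age sigma i (r : R) : (0 < T)%N ->
  \sum_(n < T) mean_age r (unblocked_at sigma i) n = age_sum r 1 (pattern sigma i).
Proof.
move=> T0; rewrite (age_sum_mean_age r (unblocked_at sigma i) 0 T.-1).
by rewrite add0n prednK // big_mkord.
Qed.

Lemma DeltaE p sigma : (0 < T)%N -> \sum_S p S = 1 ->
  Delta p sigma = (T%:R^-1 * N%:R^-1) *
    \sum_i age_sum (1 - marginal p i) 1 (pattern sigma i).
Proof.
move=> T0 p1; rewrite /Delta -mulr_sumr exchange_big /= mulrA; congr (_ * _).
apply: eq_bigr => i _; rewrite -sum_mean_age //.
by apply: eq_bigr => n _; rewrite expected_ageE // ltnW.
Qed.

Lemma sum_marginal k p : is_dist k p -> \sum_i marginal p i = k%:R.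
Proof.
move=> [_ pk p1]; rewrite /marginal.
under eq_bigr do rewrite big_mkcond; rewrite exchange_big /=.
transitivity (\sum_(S : {set 'I_N}) k%:R * p S); last first.
  by rewrite -mulr_sumr p1 mulr1.
apply: eq_bigr => S _; rewrite -big_mkcond sumr_const.
by have [<-|/pk ->] := eqVneq #|S| k; rewrite ?mul0rn ?mulr0 ?mulr_natl.
Qed.

Lemma marginal_le1 k p i : is_dist k p -> marginal p i <= 1.
Proof.
move=> [p0 _ <-]; rewrite [leRHS](bigID (fun S : {set 'I_N} => i \in S)) /=.
by rewrite lerDl sumr_ge0.
Qed.

Lemma card_blocked sigma :
  #|[set x | ~~ sigma x]| =
  (\sum_i count negb (map (unblocked_at sigma i) (iota 0 T)))%N.
Proof.
rewrite -sum1_card big_mkcond /=.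
under eq_bigr do rewrite inE.
rewrite (eq_bigr (fun x => nat_of_bool (~~ sigma (x.1, x.2)))); last first.
  by move=> [i t] _; case: (sigma _).
rewrite -(pair_bigA _ (fun i t => nat_of_bool (~~ sigma (i, t)))) /=.
apply: eq_bigr => i _; rewrite count_map -sum1_count.
have -> : iota 0 T = index_iota 0 T by rewrite /index_iota subn0.
rewrite big_mkord [RHS]big_mkcond; apply: eq_bigr => t _ /=.
by rewrite /unblocked_at valK; case: (sigma _).
Qed.

Lemma count_pattern_le sigma i :
  (count negb (pattern sigma i) <=
   count negb (map (unblocked_at sigma i) (iota 0 T)))%N.
Proof.
rewrite /pattern; case: T sigma => [|n] sigma //.
rewrite [n.+1.-1]/=; set s := unblocked_at _ _.
by rewrite -[in leqRHS]addn1 iotaD map_cat count_cat leq_addr.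
Qed.

Lemma map_nseq_const (s : nat -> bool) b m n :
  (forall j, (m <= j < m + n)%N -> s j = b) -> map s (iota m n) = nseq n b.
Proof.
move=> sb; rewrite -[n in RHS](size_iota m) -(size_map s); apply/all_pred1P.
by apply/allP => x /mapP [j]; rewrite mem_iota => /sb /= -> ->.
Qed.

(** Slots [h + 1] to [h + b] become indices [h <= n < h + b] when counted from 0. Indices beyond the
    horizon default to unblocked, consistently since [T = 2 * h + b]. *)
Lemma unblocked_middle (alpha : R) h b i0 i n :
  alpha * T%:R = b%:R -> (1 - alpha) * T%:R = (2 * h)%:R ->
  unblocked_at (middle_block T alpha i0) i n =
  ~~ [&& i == i0, (h <= n)%N & (n < h + b)%N].
Proof.
move=> aT bT; have TE : T = (2 * h + b)%N.
  by apply/eqP; rewrite -(eqr_nat R) natrD -bT -aT; apply/eqP; ring.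
rewrite /unblocked_at; case: insubP => [t tn <-|nT]; last first.
  by case: (i == i0) => //=; lia.
rewrite ffunE /= bT; congr (~~ [&& _, _ & _]).
  by rewrite natrM mulrAC divff ?pnatr_eq0 // mul1r natr1 ler_nat ltnS.
rewrite (_ : (1 + alpha) * T%:R = 2 * (h + b)%:R); last first.
  have -> : (1 + alpha) * T%:R = (1 - alpha) * T%:R + 2 * (alpha * T%:R) by ring.
  by rewrite bT aT natrM natrD; ring.
by rewrite mulrAC divff ?pnatr_eq0 // mul1r ler_nat.
Qed.

Lemma map_unblocked_middle (alpha : R) h b i0 i m :
  alpha * T%:R = b%:R -> (1 - alpha) * T%:R = (2 * h)%:R ->
  map (unblocked_at (middle_block T alpha i0) i) (iota 0 (h + (b + m))) =
  if i == i0 then nseq h true ++ nseq b false ++ nseq m true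
  else nseq (h + (b + m)) true.
Proof.
move=> aT bT; have U n := unblocked_middle alpha h b i0 i n aT bT.
case: eqP U => /= _ U; last by apply: map_nseq_const => j _; rewrite U.
rewrite !iotaD !map_cat; congr (_ ++ (_ ++ _));
  by apply: map_nseq_const => j hj; rewrite U; lia.
Qed.

End Game.

(** * The equilibrium for large horizons *)

Theorem theorem17 (R : realType) (N k ka : nat) (alpha : R)
  (hN : (2 <= N)%N) (hk1 : (1 <= k)%N) (hkN : (k <= N)%N) (hka : (1 <= ka)%N)
  (ha0 : 0 < alpha) (ha1 : alpha < 1)
  (p : {set 'I_N} -> R) (hp : is_dist k p)
  (hmarg : forall i : 'I_N, \sum_(S : {set 'I_N} | i \in S) p S = k%:R / N%:R)
  (i0 : 'I_N) :
  exists T0 : nat, forall T : nat, (T0 <= T)%N ->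
    (exists m : nat, alpha * T%:R = m%:R) ->
    (exists m : nat, (1 - alpha) * T%:R = (2 * m)%:R) ->
    [/\ feasible alpha ka (middle_block T alpha i0),
        (forall sigma : blocking N T, feasible alpha ka sigma ->
           Delta p sigma <= Delta p (middle_block T alpha i0)) &
        (forall p' : {set 'I_N} -> R, is_dist k p' ->
           worst_Delta T alpha ka p <= worst_Delta T alpha ka p')].
Proof.
have N0 : (0 : R) < N%:R by rewrite ltr0n ltnW.
pose q : R := k%:R / N%:R; pose r := 1 - q.
have q0 : 0 < q by rewrite divr_gt0 // ltr0n.
have q1 : q <= 1 by rewrite ler_pdivrMr // mul1r ler_nat.
have r0 : 0 <= r by rewrite /r; lra.
have r1 : r < 1 by rewrite /r; lra.
have e0 : 0 < (1 - r) / 6 by lra.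
(* The threshold of [expr_small] for the tolerance [(1 - r) / 6]; the bound on [T] makes half of the
   slots outside the block exceed it. *)
pose X := ((1 - r) * ((1 - r) / 6))^-1.
have X0 : 0 < X by rewrite invr_gt0 mulr_gt0 // subr_gt0.
have Y0 : 0 <= 2 * X / (1 - alpha) by rewrite divr_ge0; lra.
exists (Num.bound (2 * X / (1 - alpha))) => T leT [b aT] [m bT].
have : 2 * X < (2 * m)%:R.
  rewrite -bT -ltr_pdivrMl ?subr_gt0 // [_^-1 * _]mulrC.
  by apply: lt_le_trans (archi_boundP Y0) _; rewrite ler_nat.
rewrite natrM ltr_pM2l // => Xm.
case: m bT Xm => [|h] bT Xm; first by rewrite ltNge (ltW X0) in Xm.
have rh : r ^+ h.+1 <= (1 - r) / 6 by apply: expr_small (ltW Xm).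
have TE : T = (h.*2.+2 + b)%N.
  apply/eqP; rewrite -(eqr_nat R) natrD -doubleS -mul2n.
  by rewrite -bT -aT; apply/eqP; ring.
have T0 : (0 < T)%N by rewrite TE.
have b0 : (0 < b)%N by rewrite -(ltr_nat R) -aT mulr_gt0 ?ltr0n.
pose idle := nseq (h.*2.+1 + b) true; pose blk := block_pattern h b.
have T1E : T.-1 = (h.+1 + (b + h))%N by rewrite TE half_block_half.
have patE (j i : 'I_N) :
    pattern (middle_block T alpha j) i = if i == j then blk else idle.
  rewrite /pattern T1E (map_unblocked_middle alpha h.+1 b j i h aT bT).
  by rewrite /idle -half_block_half.
have iotaE : iota 0 T = iota 0 (h.+1 + (b + h.+1)).
  by rewrite TE !addnS half_block_half.
have feas (j : 'I_N) : feasible alpha ka (middle_block T alpha j).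
  split; last first.
    move=> t; apply: leq_trans hka; rewrite -(cards1 j) subset_leq_card //.
    by apply/subsetP => i; rewrite !inE ffunE negbK => /andP [].
  rewrite aT ler_nat card_blocked (bigD1 j) //= big1 => [|i ij].
    rewrite iotaE (map_unblocked_middle alpha h.+1 b j j h.+1 aT bT) eqxx.
    by rewrite !count_cat !count_nseq /= !mul0n mul1n add0n !addn0.
  rewrite iotaE (map_unblocked_middle alpha h.+1 b j i h.+1 aT bT) (negPf ij).
  by rewrite count_nseq.
have [_ _ p1] := hp.
have DeltaE' (sigma : blocking N T) : Delta p sigma =
    (T%:R^-1 * N%:R^-1) * \sum_i age_sum r 1 (pattern sigma i).
  rewrite (DeltaE p sigma T0 p1); congr (_ * _); apply: eq_bigr => i _.
  by rewrite /marginal hmarg.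
have c0 : (0 : R) < T%:R^-1 * N%:R^-1 by rewrite mulr_gt0 ?invr_gt0 // ltr0n.
have opt (sigma : blocking N T) : feasible alpha ka sigma ->
    Delta p sigma <= Delta p (middle_block T alpha i0).
  move=> [sigma_b _]; rewrite !DeltaE' ler_pM2l //.
  under [leRHS]eq_bigr do rewrite patE.
  set base := age_sum r 1 idle.
  (* Gain per blocked slot of the central block. Every user gains at most [K] per blocked slot, so
     the shared budget [b] caps the total gain at that of one block. *)
  pose K := (age_sum r 1 blk - base) / b%:R.
  have K0 : 0 <= K.
    rewrite divr_ge0 // subr_ge0.
    have := age_sum_nseq_true_le r 1 1 blk r0 (ltW r1) ler01 (lexx _).
    rewrite !size_cat !size_nseq /base /idle.
    by rewrite half_block_half.
  have le_base i : age_sum r 1 (pattern sigma i) <=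
      base + (count negb (pattern sigma i))%:R * K.
    have sz : size (pattern sigma i) = (h.*2.+1 + b)%N.
      by rewrite size_map size_iota TE.
    have := age_sum_le_block_pattern r h b (pattern sigma i) r0 r1 rh b0 sz.
    rewrite sz; apply; rewrite -(ler_nat R) -aT; apply: le_trans sigma_b.
    rewrite ler_nat card_blocked (bigD1 i) //=.
    exact: leq_trans (count_pattern_le sigma i) (leq_addr _ _).
  apply: le_trans (ler_sum _ (fun i _ => le_base i)) _.
  rewrite big_split /= -mulr_suml -natr_sum.
  rewrite (bigD1 i0) //= [leRHS](bigD1 i0) //= eqxx.
  rewrite [X in _ <= _ + X](eq_bigr (fun=> base)) => [|i /negPf -> //].
  have : (\sum_i count negb (pattern sigma i))%:R * K <= b%:R * K.
    apply: ler_wpM2r => //; rewrite -aT; apply: le_trans sigma_b.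
    rewrite ler_nat card_blocked; apply: leq_sum => i _; exact: count_pattern_le.
  rewrite /K [b%:R * _]mulrC divfK ?lt0r_neq0 ?ltr0n //; lra.
have wD (sigma : blocking N T) : feasible alpha ka sigma -> feasibleb alpha ka sigma.
  by move=> [? h2]; apply/andP; split=> //; apply/forallP.
split=> // p' hp'.
have worst_le : worst_Delta T alpha ka p <= Delta p (middle_block T alpha i0).
  (* The maximum starts from 0, so the payoff of the block must also be shown nonnegative. *)
  apply: bigmax_le => [|sigma /andP [s1 /forallP s2]]; last exact: opt.
  rewrite DeltaE' mulr_ge0 ?(ltW c0) // sumr_ge0 // => i _.
  exact: age_sum_ge0.
apply: le_trans worst_le _.
have le_worst j : Delta p' (middle_block T alpha j) <= worst_Delta T alpha ka p'.
  by apply: le_bigmax_cond; apply: wD.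
rewrite -(ler_pM2l N0).
apply: (@le_trans _ _ (\sum_(j : 'I_N) Delta p' (middle_block T alpha j))); last first.
  apply: le_trans (ler_sum _ (fun j _ => le_worst j)) _.
  by rewrite sumr_const card_ord mulr_natl.
have [_ _ p1'] := hp'.
(* As the blocked user [j] varies, each user is the target once and a bystander [N.-1] times; Jensen
   then applies to both patterns separately. *)
have sumN (a c : 'I_N -> R) :
    \sum_j \sum_i (if i == j then a i else c i) =
    \sum_i a i + N.-1%:R * \sum_i c i.
  rewrite exchange_big mulr_sumr -big_split; apply: eq_bigr => i _ /=.
  rewrite (bigD1 i) //= eqxx (eq_bigr (fun=> c i)) => [|j]; last first.
    by rewrite eq_sym => /negPf ->.
  by rewrite sumr_const cardC1 card_ord mulr_natl.
rewrite DeltaE' (eq_bigr _ (fun j _ => DeltaE p' _ T0 p1')) -mulr_sumr.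
rewrite mulrCA ler_pM2l //.
under [leRHS]eq_bigr => j _ do under eq_bigr => i _ do
  rewrite patE (fun_if (age_sum _ _)).
rewrite sumN.
under eq_bigr => i _ do rewrite patE (fun_if (age_sum _ _)).
rewrite (bigD1 i0) //= eqxx (eq_bigr (fun=> age_sum r 1 idle)); last first.
  by move=> i /negPf ->.
rewrite sumr_const cardC1 card_ord -[_ *+ N.-1]mulr_natl mulrDr mulrCA.
have jensen w : N%:R * age_sum r 1 w <= \sum_i age_sum (1 - marginal p' i) 1 w.
  rewrite -[N in N%:R]card_ord; apply: age_sum_jensen => // [i|].
    by rewrite subr_ge0; apply: marginal_le1 hp'.
  rewrite sumrB sumr_const (sum_marginal k) // card_ord /r mulrBr mulr1 /q.
  by rewrite mulrCA divff ?lt0r_neq0 // mulr1.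
apply: lerD; first exact: (jensen blk).
by apply: ler_wpM2l => //; exact: (jensen idle).
Qed.
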